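(* Every clear single-coalition-first neighborhood model $z$-represents a clear grand-coalition-first action model; that is, for every clear single-coalition-first neighborhood model $N$ there is a clear grand-coalition-first action model $M$ that is $z$-representable by $N$.
   Context: $AG$ is a finite nonempty set of agents, $AP$ a countable set of atomic propositions. For a nonempty set $AC$ and $C\subseteq AG$, $JA_C$ is the set of functions $\sigma_C:C\to AC$ ($JA_\emptyset=\{\emptyset\}$); $\sigma_C\subseteq\sigma_{AG}$ means $\sigma_C$ is the restriction of $\sigma_{AG}$ to $C$. A grand-coalition-first action model is $M=(ST,AC,out_{AG},L)$ with $ST,AC$ nonempty, $out_{AG}:ST\times JA_{AG}\to\mathcal P(ST)$, $L:ST\to\mathcal P(AP)$. It determines $out_C(s,\sigma_C)=\bigcup\{out_{AG}(s,\sigma_{AG})\mid\sigma_C\subseteq\sigma_{AG}\}$, $av_C(s)=\{\sigma_C\mid out_C(s,\sigma_C)\neq\emptyset\}$, and $AE_C(s)=\{out_C(s,\sigma_C)\mid\sigma_C\in av_C(s)\}$. $M$ is clear if for all $s$ and $\sigma_{AG}\neq\sigma'_{AG}$, $out_{AG}(s,\sigma_{AG})\cap out_{AG}(s,\sigma'_{AG})=\emptyset$. A single-coalition-first neighborhood model is $N=(ST,suc,\{nei_a\}_{a\in AG},L)$ with $ST$ nonempty, $suc:ST\to\mathcal P(ST)$, $L:ST\to\mathcal P(AP)$, each $nei_a(s)\subseteq\mathcal P(ST)$ a cover of $suc(s)$ (union $suc(s)$, $\emptyset\notin nei_a(s)$). With $\Delta_1\odot\Delta_2=\{Y_1\cap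 Y_2\mid Y_i\in\Delta_i,Y_1\cap Y_2\neq\emptyset\}$ (extended to finitely many families, $\bigodot\{\Delta\}=\Delta$): $nei_C(s)=\emptyset$ if $suc(s)=\emptyset$; $\{suc(s)\}$ if $suc(s)\neq\emptyset$, $C=\emptyset$; $\bigodot\{nei_a(s)\mid a\in C\}$ otherwise. $N$ is clear if for all $a,s$, $nei_a(s)$ is a partition of $suc(s)$. $M$ is $z$-representable by $N$ ($N$ $z$-represents $M$) if they share $ST$ and $L$ and $AE_C=nei_C$ for all $C\subseteq AG$. *)

(* Defs.v *)
From mathcomp Require Import all_boot.
From mathcomp Require Import boolp classical_sets.

Set Implicit Arguments.
Unset Strict Implicit.
Unset Printing Implicit Defensive.

Local Open Scope classical_set_scope.

(* The set of states is a parameter of both kinds of models, so that two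
   models sharing their states are models over the same type ST. *)

Section JointActions.
Variables (AG : finType) (AC : Type).

Definition joint_action (C : {set AG}) : Type := {a : AG | a \in C} -> AC.

Definition grand : {set AG} := finset.setT.

Definition restricts (C : {set AG})
    (sC : joint_action C) (sG : joint_action grand) : Prop :=
  forall (a : AG) (aC : a \in C) (aG : a \in grand),
    sC (exist _ a aC) = sG (exist _ a aG).

End JointActions.

Arguments grand : clear implicits.

Record action_model (AG : finType) (AP ST : Type) := ActionModel {
  AC : Type;
  action_states_nonempty : inhabited ST;
  actions_nonempty : inhabited AC;
  out_grand : ST -> joint_action AC (grand AG) -> set ST;
  action_label : ST -> set AP
}.

Section ActionModels.
Variables (AG : finType) (AP ST : Type) (M : action_model AG AP ST).

Definition out (C : {set AG}) (s : ST) (sC : joint_action (AC M) C) : set ST :=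
  \bigcup_(sG in [set sG | restricts sC sG]) out_grand s sG.

Definition available (C : {set AG}) (s : ST) : set (joint_action (AC M) C) :=
  [set sC | out s sC <> set0].

Definition actual_effects (C : {set AG}) (s : ST) : set (set ST) :=
  [set out s sC | sC in available (C := C) s].

Definition clear_action_model : Prop :=
  forall (s : ST) (sG sG' : joint_action (AC M) (grand AG)),
    sG <> sG' -> out_grand s sG `&` out_grand s sG' = set0.

End ActionModels.

Record nbhd_model (AG : finType) (AP ST : Type) := NbhdModel {
  nbhd_states_nonempty : inhabited ST;
  suc : ST -> set ST;
  nei : AG -> ST -> set (set ST);
  nbhd_label : ST -> set AP;
  nei_cover : forall (a : AG) (s : ST), cover (nei a s) id = suc s;
  nei_nonempty : forall (a : AG) (s : ST), ~ nei a s set0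
}.

Section Odot.
Variable ST : Type.

Definition odot (D1 D2 : set (set ST)) : set (set ST) :=
  [set Y | exists Y1 Y2, [/\ D1 Y1, D2 Y2, Y = Y1 `&` Y2 & Y <> set0]].

(* The value on the empty list is never used. As odot is associative and
   commutative, the order of the list is irrelevant. The argument is a list,
   i.e. an indexed collection: equal families of distinct agents both count. *)
Fixpoint bigodot (Ds : seq (set (set ST))) : set (set ST) :=
  match Ds with
  | [::] => set0
  | [:: D] => D
  | D :: Ds' => odot D (bigodot Ds')
  end.

End Odot.

Section NbhdModels.
Variables (AG : finType) (AP ST : Type) (N : nbhd_model AG AP ST).

Definition nei_coalition (C : {set AG}) (s : ST) : set (set ST) :=
  if `[< suc N s = set0 >] then set0
  else if C == finset.set0 then [set suc N s]
  else bigodot [seq nei N a s | a <- enum C].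

Definition clear_nbhd_model : Prop :=
  forall (a : AG) (s : ST), partition (nei N a s) id (suc N s).

End NbhdModels.

Definition z_represents (AG : finType) (AP ST : Type)
    (N : nbhd_model AG AP ST) (M : action_model AG AP ST) : Prop :=
  action_label M = nbhd_label N /\
  forall (C : {set AG}) (s : ST), actual_effects M C s = nei_coalition N C s.

(* Main.v *)
Require Import Defs.
From mathcomp Require Import all_boot.
From mathcomp Require Import boolp classical_sets.

(** An action is a set of states, to be read as the choice of a cell: a joint
    action of the grand coalition is effective at [s] when every agent [a]
    chooses a member of [nei a s], and its outcome is then the intersection of
    the chosen cells.  Distinct joint actions differ for some agent, whose two
    cells are disjoint, so the model is clear.  As every successor lies in a
    cell of each agent, taking the union over the choices of the agents outside
    [C] imposes no constraint, so the outcome of an effective action of [C] is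
    the intersection of the cells chosen in [C]. *)

Local Open Scope classical_set_scope.

(** Unfolding [odot] along the list amounts to choosing one member of each family and intersecting
    them. A single function [f] on indices can record the choices because no index is repeated. *)
Lemma bigodot_mapE (I : eqType) (T : Type) (D : I -> set (set T)) (l : seq I) :
  (forall i, ~ D i set0) -> l != [::] -> uniq l ->
  bigodot [seq D i | i <- l] =
  [set Y | Y <> set0 /\ exists f : I -> set T,
     (forall i, i \in l -> D i (f i)) /\
     Y = [set x | forall i, i \in l -> f i x]].
Proof.
move=> D0; elim: l => // i [|j l] IH _.
  move=> _; apply/seteqP; split=> Y /=.
    move=> DY; split; first by move=> Y0; apply: (D0 i); rewrite -Y0.
    exists (fun=> Y); split; first by move=> k; rewrite inE => /eqP ->.
    apply/seteqP; split=> x //=; apply; exact: mem_head.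
  move=> [_ [f [Df ->]]].
  suff -> : [set x | forall k, k \in [:: i] -> f k x] = f i.
    exact/Df/mem_head.
  apply/seteqP; split=> x /=; first by apply; exact: mem_head.
  by move=> fx k; rewrite inE => /eqP ->.
rewrite cons_uniq => /andP[iNl ul].
have -> : bigodot [seq D k | k <- i :: j :: l] =
  odot (D i) (bigodot [seq D k | k <- j :: l]) by [].
rewrite IH //; apply/seteqP; split=> Y /=.
  move=> [Y1 [_ [DY1 [_ [f [Df ->]]] -> Y0]]]; split=> //.
  (* Since [i] is absent from the tail, overriding [f] at [i] keeps the choices already made
     there. *)
  have fE k : k \in j :: l -> (if k == i then Y1 else f k) = f k.
    by case: eqP => // -> il; rewrite il in iNl.
  exists (fun k => if k == i then Y1 else f k); split.
    move=> k; rewrite in_cons => /orP[/eqP ->|kl]; first by rewrite eqxx.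
    by rewrite fE //; exact: Df.
  apply/seteqP; split=> x /=.
    move=> [Y1x fx] k; rewrite in_cons => /orP[/eqP ->|kl].
      by rewrite eqxx.
    by rewrite fE //; exact: fx.
  move=> fx; split; first by have := fx i (mem_head _ _); rewrite eqxx.
  move=> k kl; rewrite -(fE k kl); apply: fx.
  by rewrite in_cons kl orbT.
move=> [Y0 [f [Df YE]]].
have YI : Y = f i `&` [set x | forall k, k \in j :: l -> f k x].
  rewrite YE; apply/seteqP; split=> x /=.
    move=> fx; split; first exact/fx/mem_head.
    by move=> k kl; apply: fx; rewrite in_cons kl orbT.
  by move=> [fix_ fx] k; rewrite in_cons => /orP[/eqP ->|]; last exact: fx.
exists (f i), [set x | forall k, k \in j :: l -> f k x]; split=> //.
  exact/Df/mem_head.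
(* The tail intersection contains [Y], so it is nonempty as well. *)
split; first by move=> E; apply: Y0; rewrite YI E setI0.
by exists f; split=> // k kl; apply: Df; rewrite in_cons kl orbT.
Qed.

Section CellModel.
Variables (AG : finType) (AP ST : Type) (N : nbhd_model AG AP ST).

(** Stated for every [C]: the grand case defines the model, the others are the closed form of [out].
    The conjunct [suc N s x] yields the right value when [C] is empty. *)
Definition cell_outcome (C : {set AG}) (s : ST)
    (sC : joint_action (set ST) C) : set ST :=
  [set x | suc N s x /\ forall a (aC : a \in C),
     nei N a s (sC (exist _ a aC)) /\ sC (exist _ a aC) x].

Definition cell_model : action_model AG AP ST :=
  ActionModel (nbhd_states_nonempty N) (inhabits set0)
    (cell_outcome (grand AG)) (nbhd_label N).

Lemma out_cell_model (C : {set AG}) (s : ST)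
    (sC : joint_action (Defs.AC cell_model) C) :
  out s sC = cell_outcome C s sC.
Proof.
apply/seteqP; split=> x.
  move=> [sG /= sCG [sx sGx]]; split=> // a aC.
  by rewrite (sCG a aC (finset.in_setT a)); exact: sGx.
move=> [sx sCx].
(* Each agent gets a cell around [x]: the one prescribed by [sC] inside [C], one supplied by the
   cover outside. Choosing these cells gives a grand action extending [sC] with [x] in its
   outcome. *)
have cellP a : exists Y : set ST, [/\ nei N a s Y, Y x &
    forall aC : a \in C, sC (exist _ a aC) = Y].
  have [aC|aC] := pselect (a \in C).
    have [DY Yx] := sCx a aC.
    exists (sC (exist _ a aC)); split=> // aC'.
    by rewrite (bool_irrelevance aC' aC).
  have [Y DY Yx] : cover (nei N a s) id x by rewrite nei_cover.
  by exists Y; split=> // aC'; case: aC.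
have [c cP] := choice cellP.
exists (fun u => c (sval u)) => /=.
  by move=> a aC aG /=; have [_ _ ->] := cP a.
by split=> // a aG /=; have [] := cP a.
Qed.

Lemma cell_model_clear : clear_nbhd_model N -> clear_action_model cell_model.
Proof.
move=> clearN s sG sG' sGN; apply: contrapT => /eqP/set0P[x [[_ sGx] [_ sGx']]].
apply: sGN; apply: funext => -[a aG].
have [nY Yx] := sGx a aG; have [nY' Yx'] := sGx' a aG.
have [_ triv _] := clearN a s.
by apply: (triv _ _ nY nY'); exists x.
Qed.

Lemma actual_effects_cell_model (C : {set AG}) (s : ST) :
  actual_effects cell_model C s = nei_coalition N C s.
Proof.
have effE : actual_effects cell_model C s =
    [set Y | Y <> set0 /\ exists sC, Y = cell_outcome C s sC].
  apply/seteqP; split=> Y /=.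
    by move=> [sC avC <-]; split=> //; exists sC; rewrite out_cell_model.
  move=> [Y0 [sC YE]]; exists sC; last by rewrite out_cell_model.
  by rewrite /available /= out_cell_model -YE.
rewrite effE /nei_coalition; case: asboolP => [suc0|sucN0].
  apply/seteqP; split=> Y //= -[Y0 [sC YE]]; apply: Y0.
  by rewrite YE -subset0 -suc0 => x [].
have [C0|CN0] := eqVneq C finset.set0.
  subst C.
  have outE sC : cell_outcome finset.set0 s sC = suc N s.
    apply/seteqP; split=> x; first by move=> [].
    by move=> sx; split=> // a aC; exfalso; rewrite inE in aC.
  apply/seteqP; split=> Y /=; first by move=> [_ [sC ->]].
  by move=> ->; split=> //; exists (fun=> set0); rewrite outE.
have enumN0 : enum C != [::].
  by apply: contraNneq CN0 => E; rewrite -cards_eq0 cardE E.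
rewrite (bigodot_mapE AG ST (nei N ^~ s)) //; last exact: enum_uniq.
  apply/seteqP; split=> Y /= [Y0].
    move=> [sC YE]; split=> //.
    (* One point of [Y] certifies that all the sets chosen by [sC] are cells, a condition
       independent of the point. *)
    have /set0P[y Yy] : Y != set0 by apply/eqP.
    move: Yy; rewrite YE => -[_ sCy].
    (* Extends [sC] to all agents; the value [set0] outside [C] is a mere default. *)
    have cellP a : exists Z : set ST, forall aC : a \in C,
        sC (exist _ a aC) = Z.
      have [aC|aC] := pselect (a \in C).
        by exists (sC (exist _ a aC)) => aC'; rewrite (bool_irrelevance aC' aC).
      by exists set0 => aC'; case: aC.
    have [f fP] := choice cellP.
    have nf a : a \in C -> nei N a s (f a).
      by move=> aC; rewrite -(fP a aC); have [] := sCy a aC.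
    exists f; split=> [a|]; first by rewrite mem_enum; exact: nf.
    apply/seteqP; split=> x /=.
      move=> [_ sCx] a; rewrite mem_enum => aC.
      by rewrite -(fP a aC); have [] := sCx a aC.
    move=> fx; split.
      (* Some agent belongs to [C], and its cell lies inside [suc N s]. *)
      have /set0Pn[a aC] := CN0.
      rewrite -(nei_cover N a s); exists (f a); first exact: nf.
      by apply: fx; rewrite mem_enum.
    move=> a aC; rewrite fP; split; first exact: nf.
    by apply: fx; rewrite mem_enum.
  move=> [f [nf YE]]; split=> //; exists (fun u => f (sval u)).
  rewrite YE; apply/seteqP; split=> x /=.
    move=> fx; split.
      have /set0Pn[a aC] := CN0.
      rewrite -(nei_cover N a s).
      by exists (f a); [apply: nf | apply: fx]; rewrite mem_enum.
    by move=> a aC /=; split; [apply: nf | apply: fx]; rewrite mem_enum.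
  by move=> [_ fx] a; rewrite mem_enum => aC; have [] := fx a aC.
by move=> a; exact: nei_nonempty.
Qed.

End CellModel.

Theorem theorem5p8 (AG : finType) (AG_nonempty : 0 < #|AG|) (AP : countType)
    (ST : Type) (N : nbhd_model AG AP ST) (clearN : clear_nbhd_model N) :
  exists M : action_model AG AP ST, clear_action_model M /\ z_represents N M.
Proof.
exists (cell_model AG AP ST N); split; first exact: cell_model_clear.
by split=> // C s; exact: actual_effects_cell_model.
Qed.
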